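(* Let $A$ be the class of $(P_4,C_4,\text{co-claw})$-free graphs. For all integers $a,b\ge 3$, $$R_A(a,b)=a+2b-4.$$
   Context: All graphs are finite, undirected, without loops or multiple edges. $P_4$ and $C_4$ are the chordless path and the chordless cycle on 4 vertices; the co-claw is the disjoint union of a triangle and a single vertex (the complement of $K_{1,3}$). A graph is $(H_1,\dots,H_k)$-free if it contains none of $H_1,\dots,H_k$ as an induced subgraph. For a class $A$ of graphs, $R_A(a,b)$ is the minimum $n$ such that every graph in $A$ with at least $n$ vertices has either a clique of size $a$ or an independent set of size $b$. *)

(* Defs.v *)
From Stdlib Require List.
From mathcomp Require Import all_boot.
Set Implicit Arguments.
Unset Strict Implicit.
Unset Printing Implicit Defensive.

Record sgraph := SGraph {
  vertex :> finType;
  adj : rel vertex;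
  adj_sym : symmetric adj;
  adj_irr : irreflexive adj
}.

Definition has_induced (H G : sgraph) : Prop :=
  exists2 f : H -> G, injective f & forall x y : H, adj (f x) (f y) = adj x y.

Definition free_of (Hs : seq sgraph) (G : sgraph) : Prop :=
  List.Forall (fun H : sgraph => ~ has_induced H G) Hs.

Definition clique (G : sgraph) (S : {set G}) : Prop :=
  {in S &, forall x y, x != y -> adj x y}.

Definition independent (G : sgraph) (S : {set G}) : Prop :=
  {in S &, forall x y, ~~ adj x y}.

Definition ramsey_bound (A : sgraph -> Prop) (a b n : nat) : Prop :=
  forall G : sgraph, A G -> n <= #|G| ->
    (exists2 S : {set G}, clique S & #|S| = a) \/
    (exists2 S : {set G}, independent S & #|S| = b).

(* [is_ramsey_number A a b n] reads R_A(a, b) = n. It is a relation because for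
   an arbitrary class A the minimum is not computable. *)
Definition is_ramsey_number (A : sgraph -> Prop) (a b n : nat) : Prop :=
  ramsey_bound A a b n /\ forall m : nat, ramsey_bound A a b m -> n <= m.

Section Path.
Variable n : nat.
Definition path_adj : rel 'I_n :=
  fun i j => (i.+1 == j :> nat) || (j.+1 == i :> nat).
Lemma path_adj_sym : symmetric path_adj.
Proof. by move=> i j; rewrite /path_adj orbC. Qed.
Lemma path_adj_irr : irreflexive path_adj.
Proof. by move=> i; rewrite /path_adj orbb -[X in _ == X]addn0 -addn1 eqn_add2l. Qed.
Definition path_graph : sgraph := SGraph path_adj_sym path_adj_irr.
End Path.

(* This is the cycle C_n for n >= 3; the conjunct i != j only excludes the loop
   that the congruences would produce for n = 1. *)
Section Cycle.
Variable n : nat.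
Definition cycle_adj : rel 'I_n :=
  fun i j => (i != j) && ((i.+1 == j %[mod n]) || (j.+1 == i %[mod n])).
Lemma cycle_adj_sym : symmetric cycle_adj.
Proof. by move=> i j; rewrite /cycle_adj eq_sym orbC. Qed.
Lemma cycle_adj_irr : irreflexive cycle_adj.
Proof. by move=> i; rewrite /cycle_adj eqxx. Qed.
Definition cycle_graph : sgraph := SGraph cycle_adj_sym cycle_adj_irr.
End Cycle.

Section Complete.
Variable n : nat.
Definition complete_adj : rel 'I_n := fun i j => i != j.
Lemma complete_adj_sym : symmetric complete_adj.
Proof. by move=> i j; rewrite /complete_adj eq_sym. Qed.
Lemma complete_adj_irr : irreflexive complete_adj.
Proof. by move=> i; rewrite /complete_adj eqxx. Qed.
Definition complete_graph : sgraph := SGraph complete_adj_sym complete_adj_irr.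
End Complete.

Section DisjointUnion.
Variables G H : sgraph.
Definition dunion_adj : rel (G + H)%type := fun u v =>
  match u, v with
  | inl x, inl y => adj x y
  | inr x, inr y => adj x y
  | _, _ => false
  end.
Lemma dunion_adj_sym : symmetric dunion_adj.
Proof. by move=> [x|x] [y|y] //=; exact: adj_sym. Qed.
Lemma dunion_adj_irr : irreflexive dunion_adj.
Proof. by move=> [x|x]; exact: adj_irr. Qed.
Definition dunion_graph : sgraph := SGraph dunion_adj_sym dunion_adj_irr.
End DisjointUnion.

Definition P4 : sgraph := path_graph 4.
Definition C4 : sgraph := cycle_graph 4.
Definition co_claw : sgraph :=
  dunion_graph (complete_graph 3) (complete_graph 1).

(* Main.v *)
Require Import Defs.
From mathcomp Require Import all_boot zify.

Set Implicit Arguments.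
Unset Strict Implicit.
Unset Printing Implicit Defensive.

(** In a [(P4, C4)]-free graph the closed neighbourhoods of two adjacent
    vertices are nested.  Hence a triangle of a [(P4, C4, co-claw)]-free graph,
    which dominates the graph, contains a universal vertex: the largest of its
    three closed neighbourhoods is everything.  So the set [W] of non-universal
    vertices is triangle-free, and nestedness makes one end of every edge of [W]
    a leaf of [W]; taking leaves greedily gives an independent set of size at
    least [#|W| / 2].  Without an independent set of size [b] there are thus at
    least [a - 2] universal vertices, which form a clique of size [a] with any
    edge of [W].  The bound is attained by the join of a complete graph on
    [a - 3] vertices and a matching with [b - 1] edges. *)

(** * Structure of the free graphs: nested neighbourhoods and triangles *)

(** The disjunct [z = y] turns this into inclusion of closed neighbourhoods, N[x] in N[y] or
    conversely. *)
Definition nested_edges (G : sgraph) :=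
  forall x y : G, adj x y ->
    (forall z, adj x z -> z = y \/ adj y z) \/
    (forall z, adj y z -> z = x \/ adj x z).

Definition triangle_free (G : sgraph) (W : {set G}) :=
  forall x y z, x \in W -> y \in W -> z \in W ->
    adj x y -> adj y z -> adj x z -> False.

Definition universal (G : sgraph) : {set G} :=
  [set x | [forall y, (y != x) ==> adj x y]].

Lemma adj_neq (G : sgraph) (x y : G) : adj x y -> x != y.
Proof. by apply: contraTneq => ->; rewrite adj_irr. Qed.

Lemma universalP (G : sgraph) (x y : G) :
  x \in universal G -> y != x -> adj x y.
Proof. by rewrite inE => /forallP/(_ y)/implyP. Qed.

(** If neither inclusion holds, [x] has a private neighbour [u] and [y] a private neighbour [v].
    Then [u, x, y, v] induce C4 or P4, according to whether [u] and [v] are adjacent. *)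
Lemma P4_C4_free_nested (G : sgraph) :
  ~ has_induced P4 G -> ~ has_induced C4 G -> nested_edges G.
Proof.
move=> noP4 noC4 x y xy.
case: (boolP [forall z, adj x z ==> ((z == y) || adj y z)]) => [/forallP hx|].
  by left=> z xz; have /implyP/(_ xz)/orP[/eqP->|] := hx z; [left|right].
case/forallPn => u; rewrite negb_imply negb_or => /and3P[xu uy yu].
right=> v yv; have [->|vx] := eqVneq v x; first by left.
right; apply: contraT => xv.
have ux : u != x by rewrite eq_sym adj_neq.
have yx : y != x by rewrite eq_sym adj_neq.
have vy : v != y by rewrite eq_sym adj_neq.
have uv : u != v by apply: contraNneq yu => ->.
pose f (i : 'I_4) := nth x [:: u; x; y; v] i.
have f_inj : injective f.
  move=> i j /eqP; rewrite nth_uniq //= => [/eqP/val_inj //|].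
  by rewrite !inE !negb_or ux uy uv (eq_sym x) yx (eq_sym x v) vx (eq_sym y) vy.
have adjE := (xy, xu, yv, negPf yu, negPf xv, adj_irr,
              adj_sym u x, adj_sym u y, adj_sym v x, adj_sym v y,
              adj_sym y x, adj_sym v u).
case: (boolP (adj u v)) => uvA; [case: noC4 | case: noP4]; exists f => //;
  move=> [[|[|[|[|//]]]] hi] [[|[|[|[|//]]]] hj]; rewrite /f /= ?adjE ?uvA //;
  by rewrite ?(negPf uvA).
Qed.

Lemma co_claw_free_dominating (G : sgraph) (x y z w : G) :
  ~ has_induced co_claw G -> adj x y -> adj y z -> adj x z ->
  w \notin [:: x; y; z] -> [|| adj x w, adj y w | adj z w].
Proof.
move=> noclaw xy yz xz; rewrite !inE !negb_or => /and3P[wx wy wz].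
apply: contraT; rewrite !negb_or => /and3P[xw yw zw]; case: noclaw.
pose f (i : 'I_3 + 'I_1) :=
  match i with inl i => nth x [:: x; y; z] i | inr _ => w end.
have xyz : uniq [:: x; y; z] by rewrite /= !inE negb_or !adj_neq.
have w_nth (i : 'I_3) : nth x [:: x; y; z] i != w.
  by case: i => [[|[|[|//]]] hi] /=; rewrite eq_sym.
exists f.
  move=> [i|i] [j|j] /=.
  - by move/eqP; rewrite nth_uniq // => /eqP/val_inj ->.
  - by move/eqP; rewrite (negPf (w_nth i)).
  - by move/eqP; rewrite eq_sym (negPf (w_nth j)).
  - by rewrite (ord1 i) (ord1 j).
have adjE := (xy, yz, xz, negPf xw, negPf yw, negPf zw, adj_irr,
              adj_sym y x, adj_sym z x, adj_sym z y,
              adj_sym w x, adj_sym w y, adj_sym w z).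
move=> [[[|[|[|//]]] hi]|i] [[[|[|[|//]]] hj]|j]; rewrite /f /= ?adjE //.
by rewrite (ord1 i) (ord1 j) /complete_adj eqxx.
Qed.

Lemma nonuniversal_triangle_free (G : sgraph) :
  nested_edges G -> ~ has_induced co_claw G ->
  triangle_free (~: universal G).
Proof.
move=> nest noclaw.
(* If N[x] contains N[y] and N[z], a non-neighbour [w] of [x] is adjacent to no vertex of the
   triangle, against domination. *)
have top x y z : x \notin universal G -> adj x y -> adj y z -> adj x z ->
    (forall w, adj y w -> w = x \/ adj x w) ->
    (forall w, adj z w -> w = x \/ adj x w) -> False.
  move=> + xy yz xz hy hz; rewrite inE => /forallPn[w].
  rewrite negb_imply => /andP[wx xw].
  have wN : w \notin [:: x; y; z].
    by rewrite !inE (negPf wx) /=; apply/norP; split;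
      apply: contraNneq xw => ->.
  have /or3P[xw'|/hy[]|/hz[]] := co_claw_free_dominating noclaw xy yz xz wN;
    try by [rewrite xw' in xw | move=> e; rewrite e ?eqxx in wx xw].
have trans (x y z : G) : adj x y -> adj x z ->
    (forall w, adj y w -> w = x \/ adj x w) ->
    (forall w, adj z w -> w = y \/ adj y w) ->
    (forall w, adj z w -> w = x \/ adj x w).
  by move=> xy xz hy hz w /hz[->|/hy //]; right.
move=> x y z; rewrite !in_setC => xU yU zU xy yz xz.
have [yx zy zx] : [/\ adj y x, adj z y & adj z x].
  by rewrite (adj_sym y x) (adj_sym z y) (adj_sym z x).
(* Comparing [x] with [y], and the larger of them with [z], finds the vertex to which [top]
   applies. *)
have [hxy|hyx] := nest _ _ xy.
  have [hyz|hzy] := nest _ _ yz.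
    exact: (top z y x zU zy yx zx hyz (trans z y x zy zx hyz hxy)).
  exact: (top y x z).
have [hxz|hzx] := nest _ _ xz.
  exact: (top z x y zU zx xy zy hxz (trans z x y zx zy hxz hyx)).
exact: (top x y z).
Qed.

Lemma triangle_free_independent (G : sgraph) (W : {set G}) :
  nested_edges G -> triangle_free W ->
  exists S : {set G}, [/\ independent S, S \subset W & #|W| <= 2 * #|S|].
Proof.
move=> nest; have [n] := ubnP #|W|.
elim: n W => // n IHn W leWn Wfree.
case: (boolP [exists x in W, exists y in W, adj x y]) => [|noedge]; last first.
  exists W; split=> //; last by rewrite mul2n -addnn leq_addr.
  move=> x y xW yW; apply: contra noedge => xy.
  by apply/existsP; exists x; rewrite xW; apply/existsP; exists y; rewrite yW.
(* Since N[x] lies in N[y], a second neighbour of [x] in [W] would close a triangle. So [x] can join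
   any independent set of [W] minus [x] and [y]: two vertices removed, one gained. *)
have leaf x y : x \in W -> y \in W -> adj x y ->
    (forall z, adj x z -> z = y \/ adj y z) ->
    exists S : {set G}, [/\ independent S, S \subset W & #|W| <= 2 * #|S|].
  move=> xW yW xy hx; pose W' := W :\ x :\ y.
  have W'W : W' \subset W by rewrite /W' !subDset !setUA subsetUr.
  have yx : y \in W :\ x by rewrite !inE yW eq_sym adj_neq.
  have cW : #|W| = #|W'|.+2 by rewrite (cardsD1 x) xW (cardsD1 y (W :\ x)) yx.
  have [|u v w uW vW wW|S [Sind SW' cS]] := IHn W'; first by rewrite cW in leWn; lia.
    by apply: Wfree; apply: (subsetP W'W).
  have xS : x \notin S.
    by apply/negP => /(subsetP SW'); rewrite !inE eqxx andbF.
  have xN z : z \in S -> ~~ adj x z.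
    move=> /(subsetP SW'); rewrite !inE => /and3P[zy zx zW].
    apply/negP => xz; case: (hx z xz) => [e|yz]; first by rewrite e eqxx in zy.
    exact: (Wfree x y z).
  exists (x |: S); split.
  - move=> u v; rewrite !inE => /orP[/eqP->|uS] /orP[/eqP->|vS].
    + by rewrite adj_irr.
    + exact: xN.
    + by rewrite adj_sym xN.
    + exact: Sind.
  - by rewrite subUset sub1set xW (subset_trans SW').
  - by rewrite cardsU1 xS cW; lia.
case/existsP => x /andP[xW /existsP[y /andP[yW xy]]].
by case: (nest _ _ xy); [|rewrite adj_sym in xy]; apply: leaf.
Qed.

(** * Upper bound *)

Lemma subset_of_card (T : finType) (A : {set T}) n :
  n <= #|A| -> exists2 B : {set T}, B \subset A & #|B| = n.
Proof.
case/card_geqP => s [us <- sA]; exists [set x in s].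
  by apply/subsetP => x; rewrite inE => /sA.
by rewrite cardsE; apply/card_uniqP.
Qed.

Lemma ramsey_upper (a b : nat) : 3 <= b ->
  ramsey_bound (free_of [:: P4; C4; co_claw]) a b (a + 2 * b - 4).
Proof.
move=> hb G Gfree leG.
have [noP4 [noC4 noclaw]] : ~ has_induced P4 G /\
    ~ has_induced C4 G /\ ~ has_induced co_claw G.
  by do 3 (case/List.Forall_cons_iff: Gfree => ? Gfree).
have nest := P4_C4_free_nested noP4 noC4.
set U := universal G; set W := ~: U.
have Wfree : triangle_free W := nonuniversal_triangle_free nest noclaw.
have cUW : #|U| + #|W| = #|G| := cardsC U.
have indep (S : {set G}) : independent S -> b <= #|S| ->
    exists2 S : {set G}, independent S & #|S| = b.
  move=> Sind /subset_of_card[B BS cB]; exists B => // x y xB yB.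
  by apply: Sind; apply: (subsetP BS).
have cliq (S : {set G}) : clique S -> a <= #|S| ->
    exists2 S : {set G}, clique S & #|S| = a.
  move=> Sind /subset_of_card[B BS cB]; exists B => // x y xB yB.
  by apply: Sind; apply: (subsetP BS).
have [S [Sind _ cS]] := triangle_free_independent nest Wfree.
have [/(indep _ Sind)|ltS] := leqP b #|S|; [by right|].
case: (boolP [exists x in W, exists y in W, adj x y]) => [|noedge]; last first.
  have Wind : independent W.
    move=> x y xW yW; apply: contra noedge => xy.
    by apply/existsP; exists x; rewrite xW; apply/existsP; exists y; rewrite yW.
  have [/(indep _ Wind)|ltW] := leqP b #|W|; [by right|].
  (* Here [#|W| <= b - 1], so [#|U| >= a + b - 3 >= a]. *)
  left; apply: (cliq U); last by lia.
  by move=> x y xU yU xy; apply: universalP; rewrite // eq_sym.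
case/existsP => x /andP[xW /existsP[y /andP[yW xy]]].
(* From [#|W| <= 2 * #|S| <= 2 * (b - 1)] follows [#|U| >= a - 2]; the ends of the edge [x y] lie
   outside [U] and supply the other two vertices. *)
left; apply: (cliq (x |: (y |: U))).
  have Uadj u v : u \in U -> u != v -> adj u v.
    by move=> uU uv; apply: universalP; rewrite // eq_sym.
  move=> u v; rewrite !in_setU1 => uK vK uv.
  case: (boolP (u \in U)) => [/Uadj -> //|uU].
  case: (boolP (v \in U)) => [vU|vU]; first by rewrite adj_sym Uadj // eq_sym.
  move: uK vK; rewrite (negPf uU) (negPf vU) !orbF.
  case/pred2P=> eu; case/pred2P => ev; move: uv;
    by rewrite eu ev ?eqxx ?xy ?[adj y x]adj_sym ?xy.
rewrite cardsU1 in_setU1 negb_or adj_neq // -in_setC xW /=.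
by rewrite cardsU1 -in_setC yW; lia.
Qed.

(** * Lower bound: the extremal graph *)

Section JoinMatching.
Variables k c : nat.

(** In [inr (i, s)], [i] names the matching edge and [s] its end. *)
Definition join_matching_adj : rel ('I_k + 'I_c * bool) := fun u v =>
  (u != v) && match u, v with inr p, inr q => p.1 == q.1 | _, _ => true end.

Lemma join_matching_sym : symmetric join_matching_adj.
Proof.
move=> u v; rewrite /join_matching_adj eq_sym; congr (_ && _).
by case: u v => [i|p] [j|q] //; rewrite eq_sym.
Qed.

Lemma join_matching_irr : irreflexive join_matching_adj.
Proof. by move=> u; rewrite /join_matching_adj eqxx. Qed.

Definition join_matching : sgraph := SGraph join_matching_sym join_matching_irr.

Lemma join_matching_nonadj (u v : join_matching) : u != v -> ~~ adj u v ->
  exists p q, [/\ u = inr p, v = inr q & p.1 != q.1].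
Proof.
rewrite /= /join_matching_adj => -> /=.
by case: u => // p; case: v => // q ne; exists p, q.
Qed.

(** The two non-adjacent pairs force [v0], [v1], [v2] into the matching, where the path through [v1]
    puts [v0] and [v2] on one matching edge. Nothing is asked of the pairs [v2 v3] and [v0 v3], so
    P4 and C4 are both covered. *)
Lemma join_matching_P4_like (H : sgraph) (v0 v1 v2 v3 : H) :
  adj v0 v1 -> adj v1 v2 -> v0 != v2 -> v1 != v3 ->
  ~~ adj v0 v2 -> ~~ adj v1 v3 -> ~ has_induced H join_matching.
Proof.
move=> a01 a12 n02 n13 na02 na13 [f f_inj fadj].
rewrite -(inj_eq f_inj) in n02; rewrite -(inj_eq f_inj) in n13.
rewrite -fadj in a01; rewrite -fadj in a12.
rewrite -fadj in na02; rewrite -fadj in na13.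
have [p0 [p2 [e0 e2 /eqP]]] := join_matching_nonadj n02 na02; case.
have [p1 [_ [e1 _ _]]] := join_matching_nonadj n13 na13.
move: a01 a12; rewrite e0 e1 e2 /= /join_matching_adj.
by case/andP => _ /eqP-> /andP[_ /eqP->].
Qed.

Lemma join_matching_co_claw_free : ~ has_induced co_claw join_matching.
Proof.
move=> [f f_inj fadj].
(* Each triangle vertex misses the isolated vertex, so it lies in the matching; a single matching
   edge would then need three ends. *)
have inr_f (i : 'I_3) : exists p, f (inl i) = inr p.
  have [||p [_ [e _ _]]] := @join_matching_nonadj (f (inl i)) (f (inr ord0)).
  - by rewrite (inj_eq f_inj).
  - by rewrite fadj.
  - by exists p.
have [p ep] := inr_f (inord 0); have [q eq1] := inr_f (inord 1).
have [r er] := inr_f (inord 2).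
have neq (i j : nat) : i < 3 -> j < 3 -> i != j -> inord i != inord j :> 'I_3.
  by move=> hi hj; apply: contraNneq => /(congr1 val)/=; rewrite !inordK // => ->.
have adj_f (i j : nat) : i < 3 -> j < 3 -> i != j ->
    adj (f (inl (inord i))) (f (inl (inord j))).
  by move=> hi hj ij; rewrite fadj; apply: neq.
have := adj_f 0 1 isT isT isT; have := adj_f 0 2 isT isT isT.
have := adj_f 1 2 isT isT isT; rewrite ep eq1 er.
rewrite /= /join_matching_adj.
case: p q r {ep eq1 er} => [p s] [q t] [r w] /=.
case/andP => + /eqP E' /andP[+ _] /andP[+ /eqP E]; rewrite E E'.
by case: s; case: t; case: w; rewrite eqxx.
Qed.

Lemma join_matching_free : free_of [:: P4; C4; co_claw] join_matching.
Proof.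
do !apply: List.Forall_cons; last exact: List.Forall_nil.
- by apply: (@join_matching_P4_like P4 (inord 0) (inord 1) (inord 2) (inord 3));
    rewrite -?val_eqE /= /path_adj ?inordK.
- by apply: (@join_matching_P4_like C4 (inord 0) (inord 1) (inord 2) (inord 3));
    rewrite -?val_eqE /= /cycle_adj -?val_eqE /= ?inordK.
- exact: join_matching_co_claw_free.
Qed.

Lemma join_matching_card : #|join_matching| = k + 2 * c.
Proof. by rewrite card_sum card_prod card_bool !card_ord mulnC. Qed.

Lemma join_matching_clique (S : {set join_matching}) :
  clique S -> #|S| <= k + 2.
Proof.
(* [g] forgets the matching edge, which is the same for all matching vertices of a clique. *)
move=> Scl; pose g (u : join_matching) : 'I_k + bool :=
  match u with inl i => inl i | inr p => inr p.2 end.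
have g_inj : {in S &, injective g}.
  move=> u v uS vS guv; apply: contraTeq (erefl true) => uv.
  have := Scl u v uS vS uv; rewrite /= /join_matching_adj uv /=.
  case: u v guv uv {uS vS} => [i|[i s]] [j|[j t]] //=; first by case=> ->; rewrite eqxx.
  by case=> -> + /eqP e; rewrite e eqxx.
rewrite -(card_in_imset g_inj) (leq_trans (max_card _)) //.
by rewrite card_sum card_bool card_ord.
Qed.

End JoinMatching.

Lemma join_matching_independent k c (S : {set join_matching k c.+1}) :
  independent S -> #|S| <= c.+1.
Proof.
(* The value [ord0] on [inl] is harmless: an independent set containing such a vertex has no other
   element. *)
move=> Sind; pose g (u : join_matching k c.+1) : 'I_c.+1 :=
  match u with inl _ => ord0 | inr p => p.1 end.
have g_inj : {in S &, injective g}.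
  move=> u v uS vS guv; apply/eqP; apply: contraT => uv.
  have [p [q [eu ev]]] := join_matching_nonadj uv (Sind u v uS vS).
  by move: guv; rewrite eu ev /= => ->; rewrite eqxx.
by rewrite -(card_in_imset g_inj) (leq_trans (max_card _)) ?card_ord.
Qed.

Theorem theorem7 (a b : nat) (ha : 3 <= a) (hb : 3 <= b) :
  is_ramsey_number (free_of [:: P4; C4; co_claw]) a b (a + 2 * b - 4).
Proof.
split; first exact: ramsey_upper.
move=> m hm; rewrite leqNgt; apply/negP => ltm.
(* This graph has [(a - 3) + 2 * (b - 1) = a + 2 * b - 5] vertices, cliques of size at most [a - 1]
   and independent sets of size at most [b - 1], written [(b - 2).+1] to expose the successor. *)
have [||[S Scl cS]|[S Sind cS]] := hm (join_matching (a - 3) (b - 2).+1).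
- exact: join_matching_free.
- by rewrite join_matching_card; lia.
- by have := join_matching_clique Scl; lia.
- by have := join_matching_independent Sind; lia.
Qed.
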